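(* Let $w_1,w_2,w_3$ be any positive integers. Then for every integer $n\ge 0$ and all $y_1,y_2\in\mathbb{Z}_p$, the following six expressions are equal: \begin{align*} &w_1^{n-1}\sum_{k=0}^{n}\binom{n}{k}B_{k,\chi,\xi^{w_1w_2}}(w_3y_1)\sum_{a=0}^{dw_1-1}\chi(a)\xi^{aw_2w_3}B_{n-k,\chi,\xi^{w_1w_3}}\Big(w_2y_2+\frac{w_2}{w_1}a\Big)w_3^{n-k}w_2^{k}\\ =&w_1^{n-1}\sum_{k=0}^{n}\binom{n}{k}B_{k,\chi,\xi^{w_1w_3}}(w_2y_1)\sum_{a=0}^{dw_1-1}\chi(a)\xi^{aw_2w_3}B_{n-k,\chi,\xi^{w_1w_2}}\Big(w_3y_2+\frac{w_3}{w_1}a\Big)w_2^{n-k}w_3^{k}\\ =&w_2^{n-1}\sum_{k=0}^{n}\binom{n}{k}B_{k,\chi,\xi^{w_1w_2}}(w_3y_1)\sum_{a=0}^{dw_2-1}\chi(a)\xi^{aw_1w_3}B_{n-k,\chi,\xi^{w_2w_3}}\Big(w_1y_2+\frac{w_1}{w_2}a\Big)w_3^{n-k}w_1^{k}\\ =&w_2^{n-1}\sum_{k=0}^{n}\binom{n}{k}B_{k,\chi,\xi^{w_2w_3}}(w_1y_1)\sum_{a=0}^{dw_2-1}\chi(a)\xi^{aw_1w_3}B_{n-k,\chi,\xi^{w_1w_2}}\Big(w_3y_2+\frac{w_3}{w_2}a\Big)w_1^{n-k}w_3^{k}\\ =&w_3^{n-1}\sum_{k=0}^{n}\binom{n}{k}B_{k,\chi,\xi^{w_1w_3}}(w_2y_1)\sum_{a=0}^{dw_3-1}\chi(a)\xi^{aw_1w_2}B_{n-k,\chi,\xi^{w_2w_3}}\Big(w_1y_2+\frac{w_1}{w_3}a\Big)w_2^{n-k}w_1^{k}\\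 =&w_3^{n-1}\sum_{k=0}^{n}\binom{n}{k}B_{k,\chi,\xi^{w_2w_3}}(w_1y_1)\sum_{a=0}^{dw_3-1}\chi(a)\xi^{aw_1w_2}B_{n-k,\chi,\xi^{w_1w_3}}\Big(w_2y_2+\frac{w_2}{w_3}a\Big)w_1^{n-k}w_2^{k}. \end{align*}
   Context: Let $p$ be a fixed prime, $\mathbb{Z}_p$ the ring of $p$-adic integers, and $\mathbb{C}_p$ the completion of an algebraic closure of $\mathbb{Q}_p$. Let $\Gamma_r=\{\xi\in\mathbb{C}_p : \xi^{p^s}=1 \text{ for some } s\in\mathbb{Z}_{>0}\}$ (ramified roots of unity) and fix any $\xi\in\Gamma_r$. Let $d$ be a fixed positive integer and $\chi$ a (primitive) Dirichlet character of conductor $d$, viewed as a function $\mathbb{Z}\to\mathbb{C}_p$ via a fixed embedding $\overline{\mathbb{Q}}\to\mathbb{C}_p$ (periodic mod $d$, zero on integers not coprime to $d$; if $d=1$, $\chi\equiv 1$). For $\eta\in\Gamma_r$, the generalized twisted Bernoulli polynomials $B_{n,\chi,\eta}(x)$ attached to $\chi$ and $\eta$ are the polynomials in $x$ with coefficients in $\mathbb{C}_p$ (hence evaluable at any element of $\mathbb{C}_p$) defined by the power series expansion in $t$ $$\frac{te^{xt}}{\eta^{d}e^{dt}-1}\sum_{a=0}^{d-1}\chi(a)\eta^{a}e^{at}=\sum_{n=0}^{\infty}B_{n,\chi,\eta}(x)\frac{t^n}{n!}.$$ *)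

(* Defs.v *)
From HB Require Import structures.
From mathcomp Require Import all_boot all_order all_algebra all_field.
From mathcomp Require Import boolp classical_sets reals.
Set Implicit Arguments.
Unset Strict Implicit.
Unset Printing Implicit Defensive.
Import Order.TTheory GRing.Theory Num.Theory.
Local Open Scope classical_set_scope.
Local Open Scope ring_scope.

Section PadicComplex.
Variables (R : realType) (K : fieldType) (v : K -> R).

Definition cauchy_seq (u : nat -> K) : Prop :=
  forall e : R, 0 < e ->
    exists N, forall m n, (N <= m)%N -> (N <= n)%N -> v (u m - u n) < e.

Definition converges_to (u : nat -> K) (l : K) : Prop :=
  forall e : R, 0 < e -> exists N, forall n, (N <= n)%N -> v (u n - l) < e.

Definition closure_of (A : set K) : set K :=
  [set x | forall e : R, 0 < e -> exists2 y, A y & v (x - y) < e].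

(* When K is complete and v restricts to the p-adic absolute value on the
   rationals, the closure of the rationals is the completion Q_p. *)
Definition padic_num : set K := closure_of (range (fun q : rat => ratr q : K)).

Definition padic_int : set K := [set x | padic_num x /\ v x <= 1].

Definition padic_alg : set K :=
  [set x | exists P : {poly K}, [/\ P != 0, forall i, padic_num P`_i & root P x]].

(* (K, v) is a completion of an algebraic closure of Q_p, with v normalized by
   v p = 1/p: K is a complete non-archimedean valued field in which padic_alg is
   algebraically closed and dense. This determines (K, v) up to isometric
   isomorphism. *)
Record is_Cp (p : nat) : Prop := IsCp {
  Cp_abs_ge0 : forall x, 0 <= v x ;
  Cp_abs_eq0 : forall x, v x = 0 <-> x = 0 ;
  Cp_absM : forall x y, v (x * y) = v x * v y ;
  Cp_abs_ultra : forall x y, v (x + y) <= Num.max (v x) (v y) ;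
  Cp_abs_nat : forall m : nat, (0 < m)%N -> v m%:R = p%:R ^- logn p m ;
  Cp_complete : forall u, cauchy_seq u -> exists l, converges_to u l ;
  Cp_alg_closed : forall P : {poly K}, (1 < size P)%N ->
    (forall i, padic_alg P`_i) -> exists2 x, padic_alg x & root P x ;
  Cp_alg_dense : closure_of padic_alg = setT }.

Lemma Cp_pchar0 p : is_Cp p -> prime p -> [pchar K] =i pred0.
Proof.
move=> hK p_pr; apply/pcharf0P; case=> [|m]; first by rewrite mulr0n !eqxx.
apply/negP/negP/eqP => /(Cp_abs_eq0 hK _).2 /eqP; rewrite (Cp_abs_nat hK) //.
rewrite invr_eq0 expf_eq0 pnatr_eq0 => /andP[_ /eqP p0].
by rewrite p0 in p_pr.
Qed.

End PadicComplex.

Definition Gamma_r (p : nat) (K : fieldType) : set K :=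
  [set x | exists2 s, (0 < s)%N & x ^+ (p ^ s) = 1].

Record dirichlet_character (d : nat) (chi : int -> algC) : Prop :=
  DirichletCharacter {
    dchar_periodic : forall m, chi (m + d%:Z) = chi m ;
    dcharM : forall m n, chi (m * n) = chi m * chi n ;
    dchar_eq0 : forall m, (chi m == 0) = ~~ coprimez m d%:Z }.

(* Conductor d means that chi does not factor through the units mod e for any
   proper divisor e of the modulus d. *)
Definition primitive_dirichlet (d : nat) (chi : int -> algC) : Prop :=
  dirichlet_character d chi /\
  forall e : nat, (e %| d)%N -> (e < d)%N ->
    ~ (forall m n : int, coprimez m d%:Z -> coprimez n d%:Z ->
         (m = n %[mod e%:Z])%Z -> chi m = chi n).

Section PowerSeries.
Variable A : idomainType.

(* A formal power series in t over A is the sequence of its coefficients. *)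
Definition fps_mul (f g : nat -> A) (n : nat) : A :=
  \sum_(i < n.+1) f i * g (n - i)%N.

(* The quotient f / g, for g != 0 dividing f in A[[t]]; it is then unique
   because A[[t]] is a domain. *)
Definition fps_div (f g : nat -> A) : nat -> A :=
  xget (fun=> 0) [set q : nat -> A | fps_mul g q = f].

Definition fps_one (n : nat) : A := (n == 0%N)%:R.

Definition fps_t (n : nat) : A := (n == 1%N)%:R.

Lemma fps_mul_eq0 (g q : nat -> A) :
  g <> (fun=> 0) -> fps_mul g q = (fun=> 0) -> q = (fun=> 0).
Proof.
move=> gN0 gq0.
have ex_g : exists i, g i != 0.
  apply: contrapT => ng; apply: gN0; apply/funext => i.
  by apply/eqP/negPn/negP => gi; apply: ng; exists i.
case: (ex_minnP ex_g) => m gm minm; apply/funext => n.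
elim/ltn_ind: n => n IH.
have := congr1 (fun f => f (m + n)%N) gq0; rewrite /fps_mul /=.
have lt_m : (m < (m + n).+1)%N by rewrite ltnS leq_addr.
rewrite (bigD1 (Ordinal lt_m)) //= big1 ?addr0 => [|i neq_im].
  by rewrite addKn => /eqP; rewrite mulf_eq0 (negPf gm) => /eqP.
case: (ltngtP i m) => [lt_im|lt_mi|eq_im].
- have [->|/minm] := eqVneq (g i) 0; first by rewrite mul0r.
  by rewrite leqNgt lt_im.
- rewrite IH ?mulr0 // -[X in (_ < X)%N](addKn m) ltn_sub2l //.
  by rewrite (leq_trans lt_mi) // -ltnS.
- by case/eqP: neq_im; apply: val_inj.
Qed.

Lemma fps_divE (f g q : nat -> A) :
  g <> (fun=> 0) -> fps_mul g q = f -> fps_div f g = q.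
Proof.
move=> gN0 gq.
have gq' : fps_mul g (fps_div f g) = f.
  exact: (@xgetPex _ (fun=> 0) [set q | fps_mul g q = f] (ex_intro _ q gq)).
have /(fps_mul_eq0 gN0) q0 : fps_mul g (fun n => fps_div f g n - q n) = (fun=> 0).
  apply/funext => n; rewrite /fps_mul.
  under eq_bigr do rewrite mulrBr.
  by rewrite sumrB -!/(fps_mul _ _ n) gq' gq subrr.
by apply/funext => n; apply/eqP; rewrite -subr_eq0 -[_ - _]/((fun n => _) n) q0.
Qed.

Fixpoint fps_solve_seq (c : A) (f g : nat -> A) (n : nat) : seq A :=
  if n is m.+1 then
    let s := fps_solve_seq c f g m in
    rcons s (c * (f m - \sum_(i < m) g i.+1 * s`_(m - i.+1)))
  else [::].

Lemma fps_solve (f g : nat -> A) :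
  g 0%N \is a GRing.unit -> exists q, fps_mul g q = f.
Proof.
move=> g0; pose S := fps_solve_seq (g 0%N)^-1 f g.
have szS n : size (S n) = n by elim: n => //= n IH; rewrite size_rcons IH.
have SE n i : (i < n)%N -> (S n)`_i = (S i.+1)`_i.
  elim: n => // n IH; rewrite ltnS leq_eqVlt => /predU1P[->//|lt_in].
  by rewrite {1}/S /= nth_rcons szS lt_in -IH.
exists (fun n => (S n.+1)`_n); apply/funext => n; rewrite /fps_mul.
rewrite big_ord_recl /= subn0 nth_rcons szS ltnn eqxx mulVKr //.
rewrite -[RHS](subrK (\sum_(i < n) g i.+1 * (S n)`_(n - i.+1))); congr (_ + _).
apply: eq_bigr => i _; rewrite /bump /= add1n; congr (_ * _).
apply/esym/SE; by rewrite ltn_subrL (leq_ltn_trans _ (ltn_ord i)).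
Qed.

End PowerSeries.

Section Bernoulli.
Variable K : fieldType.
Local Notation A := {poly K}.

(* The series e^{ct}. *)
Definition fps_exp (c : A) (n : nat) : A := (n`!%:R^-1 : K) *: c ^+ n.

Variables (d : nat) (chi : int -> K) (eta : K).

(* The series t e^{xt}, eta^d e^{dt} - 1 and
   sum_(0 <= a < d) chi(a) eta^a e^{at}, over K[x] with x = 'X. *)
Definition bern_num : nat -> A := fps_mul (@fps_t A) (fps_exp 'X).

Definition bern_den (n : nat) : A :=
  eta ^+ d *: fps_exp d%:R n - fps_one A n.

Definition bern_char (n : nat) : A :=
  \sum_(a < d) (chi a%:Z * eta ^+ a) *: fps_exp a%:R n.

(* B_{n,chi,eta}, as n! times the n-th coefficient of the generating series. *)
Definition gen_bernoulli (n : nat) : A :=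
  (n`!%:R : K) *: fps_mul (fps_div bern_num bern_den) bern_char n.

(* In characteristic 0 the quotient exists in K[x][[t]], also when
   eta^d = 1: the factor t in the numerator then cancels. *)
Lemma bern_divK : [pchar K] =i pred0 -> (0 < d)%N -> eta != 0 ->
  fps_mul bern_den (fps_div bern_num bern_den) = bern_num.
Proof.
move=> /pcharf0P K0 d0 eta0.
suff [q dq] : exists q, fps_mul bern_den q = bern_num.
  exact: (@xgetPex _ (fun=> 0) [set q | fps_mul bern_den q = bern_num]
            (ex_intro _ q dq)).
have den0 : bern_den 0%N = (eta ^+ d - 1)%:P.
  by rewrite /bern_den /fps_exp /fps_one fact0 invr1 scale1r expr0 alg_polyC rmorphB.
have den1 : bern_den 1%N = (eta ^+ d * d%:R)%:P.
  rewrite /bern_den /fps_exp /fps_one subr0 invr1 scale1r expr1.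
  by rewrite -polyC_natr -mul_polyC polyCM.
have [ed|ed] := eqVneq (eta ^+ d) 1; last first.
  by apply: fps_solve; rewrite den0 poly_unitE coefC size_polyC subr_eq0 ed unitfE subr_eq0.
have [|q dq] := @fps_solve A (fps_exp 'X) (fun n => bern_den n.+1).
  have e1 : eta ^+ d * d%:R != 0 by rewrite mulf_neq0 ?expf_neq0 // K0 -lt0n.
  by rewrite den1 poly_unitE coefC size_polyC e1 unitfE.
exists q; apply/funext => -[|n].
  rewrite /bern_num /fps_mul !big_ord1 den0 ed subrr polyC0 mul0r.
  by rewrite /fps_t mul0r.
rewrite /fps_mul big_ord_recl den0 ed subrr polyC0 mul0r add0r.
rewrite [RHS]/bern_num /fps_mul [RHS]big_ord_recl [fps_t _ _]/fps_t mul0r add0r.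
rewrite [RHS]big_ord_recl mul1r [X in _ = _ + X]big1 => [|i _].
  by rewrite addr0 /= subSS subn0 -dq.
by rewrite [fps_t _ _]/fps_t mul0r.
Qed.

End Bernoulli.

(* Main.v *)
(** With E = xi e^t, D(m) = E^(dm) - 1 and C(m) = \sum_(a < d) chi(a) E^(am),
  each of the six expressions is n! times the coefficient of t^n in a series F such that
    D(w1 w2) D(w1 w3) D(w2 w3) F
      = w1 w2 w3 t^2 e^(w1 w2 w3 (y1 + y2) t)
          C(w1 w2) C(w1 w3) C(w2 w3) (E^(d w1 w2 w3) - 1).
  The sum over a < d w1 contributes the factor C(w2 w3) and the quotient
  (E^(d w1 w2 w3) - 1) / D(w2 w3), chi being d-periodic. The right-hand side and
  the cofactor of F are symmetric in w1, w2, w3, and K[[t]] is a domain. *)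

Require Import Defs.
From HB Require Import structures.
From mathcomp Require Import all_boot all_order all_algebra all_field.
From mathcomp Require Import boolp classical_sets reals functions ring.
Set Implicit Arguments.
Unset Strict Implicit.
Import Order.TTheory GRing.Theory Num.Theory.
Local Open Scope ring_scope.

(* An alias, so that the Cauchy product does not compete with the pointwise
   structure on functions. *)
Definition fps (K : fieldType) : Type := nat -> K.

(** * The ring K[[t]], substitutions and exponential series *)

Section PowerSeriesRing.
Variable K : fieldType.
Implicit Types f g h : fps K.

HB.instance Definition _ := GRing.Zmodule.copy (fps K) (nat -> K).

Lemma fps_addE f g n : (f + g) n = f n + g n. Proof. by []. Qed.

Lemma fps_sumE I (r : seq I) (P : pred I) (F : I -> fps K) n :
  (\sum_(i <- r | P i) F i) n = \sum_(i <- r | P i) F i n.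
Proof. by elim/big_rec2: _ => // i x y _ <-. Qed.

(** The n-th coefficient of a product involves only coefficients of index at most n, so truncation
    to polynomials loses nothing; this carries associativity and commutativity over from
    [{poly K}]. *)
Lemma fps_mul_poly N f g n : (n < N)%N ->
  fps_mul f g n = ((\poly_(i < N) f i) * (\poly_(i < N) g i))`_n.
Proof.
move=> nN; rewrite coefM; apply: eq_bigr => i _; rewrite !coef_poly.
by rewrite (leq_ltn_trans _ nN) ?(leq_ltn_trans _ nN) ?leq_subr // -ltnS.
Qed.

Lemma fps_mulA : associative (@fps_mul K).
Proof.
move=> f g h; apply/funext => n.
pose P (u : fps K) := \poly_(i < n.+1) u i.
have PM (u w : fps K) i : (i < n.+1)%N -> (P (fps_mul u w))`_i = (P u * P w)`_i.
  by move=> lt_in; rewrite -fps_mul_poly // coef_poly lt_in.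
rewrite !(@fps_mul_poly n.+1) // -!/(P _).
transitivity (P f * (P g * P h))`_n.
  by rewrite !coefM; apply: eq_bigr => i _; rewrite PM // ltnS leq_subr.
by rewrite mulrA !coefM; apply: eq_bigr => i _; rewrite PM.
Qed.

Lemma fps_mulC : commutative (@fps_mul K).
Proof.
by move=> f g; apply/funext => n; rewrite !(@fps_mul_poly n.+1) // mulrC.
Qed.

Lemma fps_mul1 : left_id (@fps_one K) (@fps_mul K).
Proof.
move=> f; apply/funext => n.
rewrite /fps_mul big_ord_recl subn0 mul1r big1 ?addr0 // => i _.
by rewrite mul0r.
Qed.

Lemma fps_mulDl : left_distributive (@fps_mul K) +%R.
Proof.
move=> f g h; apply/funext => n; rewrite /fps_mul fps_addE -big_split.
by apply: eq_bigr => i _; exact: mulrDl.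
Qed.

Lemma fps_one_neq0 : (@fps_one K : fps K) != 0.
Proof.
by apply/eqP => /(congr1 (fun f => f 0%N)) /eqP; rewrite oner_eq0.
Qed.

HB.instance Definition _ := GRing.Zmodule_isComNzRing.Build (fps K)
  fps_mulA fps_mulC fps_mul1 fps_mulDl fps_one_neq0.

Lemma fps_mulE f g n : (f * g) n = \sum_(i < n.+1) f i * g (n - i)%N.
Proof. by []. Qed.

(** Absence of zero divisors, in the form that later cancels the common denominator. *)
Lemma fps_mulfI f : f != 0 -> injective ( *%R f).
Proof.
move=> f0 g h /eqP; rewrite -subr_eq0 -mulrBr => /eqP fgh.
apply/eqP; rewrite -subr_eq0; apply/eqP; apply: (@fps_mul_eq0 K f) => //.
by move=> /eqP; apply/negP.
Qed.

Lemma fps_mulf_neq0 f g : f != 0 -> g != 0 -> f * g != 0.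
Proof.
move=> f0; apply: contra_neq => fg0.
by apply: (fps_mulfI f0); rewrite fg0 mulr0.
Qed.

(** The substitution of c t for t, which is a ring endomorphism of K[[t]]. *)
Definition rescale (c : K) f : fps K := fun n => c ^+ n * f n.

Lemma rescale_zmod c : zmod_morphism (rescale c).
Proof. by move=> f g; apply/funext => n; exact: mulrBr. Qed.

Lemma rescale_monoid c : monoid_morphism (rescale c).
Proof.
split=> [|f g]; apply/funext => n.
  by rewrite /rescale; case: n => [|n]; rewrite ?mul1r // mulr0.
rewrite /rescale !fps_mulE mulr_sumr; apply: eq_bigr => i _.
by rewrite mulrACA -exprD subnKC // -ltnS.
Qed.

HB.instance Definition _ c :=
  GRing.isZmodMorphism.Build (fps K) (fps K) (rescale c) (rescale_zmod c).
HB.instance Definition _ c :=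
  GRing.isMonoidMorphism.Build (fps K) (fps K) (rescale c) (rescale_monoid c).

(* The series a e^{ct}; a constant a is [sexp a 0]. *)
Definition sexp (a c : K) : fps K := fun n => a * (n`!%:R^-1 * c ^+ n).

Lemma rescale_sexp b a c : rescale b (sexp a c) = sexp a (b * c).
Proof.
by apply/funext => n; rewrite /rescale /sexp exprMn; ring.
Qed.

Lemma sexp0E a n : sexp a 0 n = if n == 0%N then a else 0.
Proof.
case: n => [|n]; first by rewrite /sexp fact0 invr1 !mulr1.
by rewrite /sexp expr0n !mulr0.
Qed.

Lemma sexp10 : sexp 1 0 = 1.
Proof. by apply/funext => -[|n]; rewrite sexp0E. Qed.

Lemma sexp0M a f n : (sexp a 0 * f) n = a * f n.
Proof.
rewrite fps_mulE big_ord_recl subn0 sexp0E big1 ?addr0 // => i _.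
by rewrite sexp0E mul0r.
Qed.

Lemma sexpZ a b c : sexp a 0 * sexp b c = sexp (a * b) c.
Proof. by apply/funext => n; rewrite sexp0M mulrA. Qed.

Lemma rescale_t c : rescale c (@fps_t K) = sexp c 0 * (@fps_t K : fps K).
Proof.
apply/funext => n; rewrite sexp0M /rescale /fps_t.
by case: n => [|[|n]]; rewrite ?mulr0.
Qed.

Hypothesis K0 : [pchar K] =i pred0.

Lemma natf0_neq0 n : (0 < n)%N -> n%:R != 0 :> K.
Proof. by move/pcharf0P: K0 => ->; case: n. Qed.

(** The binomial theorem divided by n!, which is invertible in characteristic 0. *)
Lemma sexpM a b c c' : sexp a c * sexp b c' = sexp (a * b) (c + c').
Proof.
(* [exprDn] puts the exponent i on the second summand, whereas in the Cauchy product it is on c;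
   hence the swap. *)
apply/funext => n; rewrite fps_mulE /sexp addrC exprDn !mulr_sumr.
apply: eq_bigr => i _.
have le_in : (i <= n)%N by rewrite -ltnS.
have i0 := natf0_neq0 (fact_gt0 i); have ni0 := natf0_neq0 (fact_gt0 (n - i)).
have n0 := natf0_neq0 (fact_gt0 n).
have := congr1 (fun m => m%:R : K) (bin_fact le_in); rewrite !natrM => binE.
rewrite -mulr_natr -binE; field; rewrite i0 ni0 /=.
(* The binomial coefficient is nonzero in K because it divides n!. *)
by apply: contraNneq n0 => b0; rewrite -binE b0 mul0r.
Qed.

Lemma sexpX a c n : sexp a c ^+ n = sexp (a ^+ n) (c *+ n).
Proof.
elim: n => [|n IH]; first by rewrite mulr0n !expr0 sexp10.
by rewrite exprS IH sexpM -exprS mulrS.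
Qed.

End PowerSeriesRing.

(** By periodicity, the block of indices from d w to d w + d - 1 contributes u^(d w) times the sum
    over the first block; multiplying by u^d - 1 makes the blocks telescope. *)
Lemma sum_periodic_geometric (A : comPzRingType) (c : nat -> A) (d : nat)
    (u : A) (w : nat) :
  (forall a, c (a + d)%N = c a) ->
  (u ^+ d - 1) * \sum_(a < d * w) c a * u ^+ a =
  (\sum_(a < d) c a * u ^+ a) * (u ^+ (d * w) - 1).
Proof.
move=> cd; elim: w => [|w IH].
  by rewrite muln0 big_ord0 expr0 subrr !mulr0.
have cdw a : c (d * w + a)%N = c a.
  by elim: w {IH} => [|w IH]; rewrite ?muln0 // mulnS -addnA addnC cd.
rewrite mulnSr big_split_ord /= mulrDr IH.
under [X in _ + _ * X]eq_bigr do rewrite cdw exprD mulrCA.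
by rewrite -mulr_sumr exprD; ring.
Qed.

(** * Generating series of the twisted Bernoulli polynomials *)

Section BernoulliSeries.
Variables (K : fieldType) (K0 : [pchar K] =i pred0).
Variables (d : nat) (d_gt0 : (0 < d)%N).
Variables (chi : int -> K) (chi_per : forall m, chi (m + d%:Z) = chi m).

Definition bern_series (eta x : K) : fps K :=
  fun n => (gen_bernoulli d chi eta n).[x] / n`!%:R.

Local Notation T := (@fps_t K : fps K).

(** Evaluating coefficients at x respects Cauchy products, so the identity [bern_divK] in K[X][[t]]
    descends to K[[t]]. Clearing the denominator also covers the case eta^d = 1. *)
Lemma bern_seriesE eta x : eta != 0 ->
  (sexp eta 1 ^+ d - 1) * bern_series eta x =
  T * sexp 1 x * \sum_(a < d) sexp (chi a%:Z) 0 * sexp eta 1 ^+ a.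
Proof.
move=> eta0.
pose ev (f : nat -> {poly K}) : fps K := fun n => (f n).[x].
have evM f g : ev (fps_mul f g) = ev f * ev g.
  apply/funext => n; rewrite /ev /fps_mul horner_sum fps_mulE.
  by apply: eq_bigr => i _; rewrite hornerM.
have ev_exp c : ev (fps_exp c) = sexp 1 c.[x].
  by apply/funext => n; rewrite /ev /fps_exp hornerZ horner_exp /sexp mul1r.
have ev_t : ev (@fps_t _) = T.
  by apply/funext => n; rewrite /ev /fps_t -polyC_natr hornerC.
have ev_one : ev (@fps_one _) = 1.
  by apply/funext => n; rewrite /ev /fps_one -polyC_natr hornerC.
have ev_den : ev (bern_den d eta) = sexp eta 1 ^+ d - 1.
  rewrite sexpX // -ev_one -[eta ^+ d]mulr1 -sexpZ.
  apply/funext => n; rewrite /ev /bern_den.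
  rewrite hornerD hornerN hornerZ /= -[RHS]/(_ - _).
  rewrite sexp0M; congr (_ * _ - _).
  by rewrite -[LHS]/(ev _ n) ev_exp -polyC_natr hornerC.
have ev_char : ev (bern_char d chi eta) =
    \sum_(a < d) sexp (chi a%:Z) 0 * sexp eta 1 ^+ a.
  apply/funext => n; rewrite /ev /bern_char fps_sumE horner_sum.
  apply: eq_bigr => a _; rewrite sexpX // sexpZ hornerZ.
  rewrite -[(fps_exp _ _).[x]]/(ev _ n) ev_exp -polyC_natr hornerC.
  by rewrite /sexp mul1r.
have -> : bern_series eta x =
    ev (fps_div (bern_num K) (bern_den d eta)) * ev (bern_char d chi eta).
  rewrite -evM; apply/funext => n; rewrite /bern_series /gen_bernoulli hornerZ.
  by rewrite mulrC mulKf // natf0_neq0 // fact_gt0.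
by rewrite -ev_char -ev_den mulrA -evM bern_divK // /bern_num evM ev_t ev_exp hornerX.
Qed.

Variables (xi : K) (xi0 : xi != 0).
Local Notation E := (sexp xi 1).
(** [charsum m] and [den m] are the series C(m) and D(m). *)
Let charsum m : fps K := \sum_(a < d) sexp (chi a%:Z) 0 * (E ^+ m) ^+ a.
Let den m : fps K := (E ^+ m) ^+ d - 1.

(** The constant term xi^(m d) - 1 may vanish, but the coefficient of t is m d xi^(m d). *)
Lemma den_neq0 m : (0 < m)%N -> den m != 0.
Proof.
move=> m0; apply/eqP => /(congr1 (fun f : fps K => f 1%N)) /eqP.
rewrite /den !sexpX // -[X in X == _]/(_ - 0) subr0 /sexp expr1 invr1 mul1r.
rewrite -mulrnA -exprM mulf_eq0 expf_eq0 (negPf xi0) andbF /=.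
by rewrite (negPf (natf0_neq0 K0 _)) // muln_gt0 m0.
Qed.

(** Substituting m t for t in [bern_seriesE] at eta = xi^m turns xi^m e^t into E^m. *)
Lemma rescale_bern_series m x :
  den m * rescale m%:R (bern_series (xi ^+ m) x) =
  sexp m%:R 0 * T * sexp 1 (m%:R * x) * charsum m.
Proof.
have rE : rescale m%:R (sexp (xi ^+ m) 1) = E ^+ m.
  by rewrite rescale_sexp sexpX // mulr1.
have := congr1 (rescale m%:R) (@bern_seriesE (xi ^+ m) x (expf_neq0 m xi0)).
rewrite !rmorphM rmorphB rmorph1 rmorphXn /= rE rescale_t rescale_sexp => ->.
rewrite rmorph_sum; congr (_ * _); apply: eq_bigr => a _.
by rewrite rmorphM rmorphXn /= rE rescale_sexp mulr0.
Qed.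

(** * The six expressions as coefficients of series, and their symmetry *)

Variables y1 y2 : K.

(** The first of the six expressions; permuting w1, w2, w3 yields the others. The exponent n - 1 is
    an integer, equal to -1 when n = 0. *)
Definition bern_conv (n w1 w2 w3 : nat) : K :=
  w1%:R ^ (n%:Z - 1) * \sum_(k < n.+1) 'C(n, k)%:R
    * (gen_bernoulli d chi (xi ^+ (w1 * w2)) k).[w3%:R * y1]
    * (\sum_(a < d * w1) chi a%:Z * xi ^+ (a * w2 * w3)
       * (gen_bernoulli d chi (xi ^+ (w1 * w3)) (n - k)).[w2%:R * y2 + w2%:R / w1%:R * a%:R])
    * w3%:R ^+ (n - k) * w2%:R ^+ k.

(** The series F. The two rescalings supply (w1 w2)^k and (w1 w3)^(n - k); with the factor 1 / w1,
    the powers of w1 combine to w1^(n - 1). *)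
Let convs w1 w2 w3 : fps K :=
  sexp w1%:R^-1 0
  * rescale (w1 * w2)%:R (bern_series (xi ^+ (w1 * w2)) (w3%:R * y1))
  * \sum_(a < d * w1) sexp (chi a%:Z * xi ^+ (a * w2 * w3)) 0
    * rescale (w1 * w3)%:R
        (bern_series (xi ^+ (w1 * w3)) (w2%:R * y2 + w2%:R / w1%:R * a%:R)).

Lemma bern_convE n w1 w2 w3 : (0 < w1)%N ->
  bern_conv n w1 w2 w3 = n`!%:R * convs w1 w2 w3 n.
Proof.
move=> w1_gt0; have w10 := natf0_neq0 K0 w1_gt0.
rewrite /bern_conv /convs -mulrA sexp0M fps_mulE !mulr_sumr.
apply: eq_bigr => k _; rewrite fps_sumE.
have le_kn : (k <= n)%N by rewrite -ltnS.
have k0 := natf0_neq0 K0 (fact_gt0 k).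
have nk0 := natf0_neq0 K0 (fact_gt0 (n - k)).
rewrite -(bin_fact le_kn) !natrM !(mulr_sumr, mulr_suml).
apply: eq_bigr => a _; rewrite sexp0M /rescale /bern_series.
have -> : w1%:R ^ (n%:Z - 1) = w1%:R ^+ k * w1%:R ^+ (n - k) / w1%:R :> K.
  by rewrite -exprD subnKC // expfzDr // exprN1.
rewrite !exprMn.
by field; rewrite k0 nk0.
Qed.

(** Each denominator clears one factor: D(w1 w2) the first Bernoulli series, D(w1 w3) those in the
    inner sum, and D(w2 w3) the remaining character sum over a < d w1. *)
Lemma convsE w1 w2 w3 : (0 < w1)%N ->
  den (w1 * w2) * den (w1 * w3) * den (w2 * w3) * convs w1 w2 w3 =
  sexp (w1 * w2 * w3)%:R 0 * T ^+ 2
  * sexp 1 ((w1 * w2 * w3)%:R * (y1 + y2))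
  * charsum (w1 * w2) * charsum (w1 * w3) * charsum (w2 * w3)
  * (E ^+ (w1 * w2 * w3 * d) - 1).
Proof.
move=> w1_gt0; have w10 := natf0_neq0 K0 w1_gt0.
(* The shift (w2 / w1) a, multiplied by w1 w3, gives the exponential e^(w2 w3 a t), which joins
   xi^(a w2 w3) to form (E^(w2 w3))^a. *)
have inner :
    den (w1 * w3) * \sum_(a < d * w1) sexp (chi a%:Z * xi ^+ (a * w2 * w3)) 0
      * rescale (w1 * w3)%:R
        (bern_series (xi ^+ (w1 * w3)) (w2%:R * y2 + w2%:R / w1%:R * a%:R)) =
    sexp (w1 * w3)%:R 0 * T * sexp 1 ((w1 * w2 * w3)%:R * y2)
    * charsum (w1 * w3)
    * \sum_(a < d * w1) sexp (chi a%:Z) 0 * (E ^+ (w2 * w3)) ^+ a.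
  rewrite mulr_sumr [RHS]mulr_sumr; apply: eq_bigr => a _.
  rewrite mulrCA rescale_bern_series.
  have -> : sexp 1 ((w1 * w3)%:R * (w2%:R * y2 + w2%:R / w1%:R * a%:R)) =
      sexp 1 ((w1 * w2 * w3)%:R * y2) * sexp 1 (w2 * w3 * a)%:R.
    by rewrite sexpM // mulr1; congr (sexp _ _); rewrite !natrM; field.
  rewrite -exprM sexpX //.
  have -> : sexp (chi a%:Z * xi ^+ (a * w2 * w3)) 0 =
      sexp (chi a%:Z) 0 * sexp (xi ^+ (w2 * w3 * a)) 0.
    by rewrite sexpZ; congr (sexp (_ * xi ^+ _) _); ring.
  have -> : sexp (xi ^+ (w2 * w3 * a)) (1 *+ (w2 * w3 * a)) =
      sexp (xi ^+ (w2 * w3 * a)) 0 * sexp 1 (w2 * w3 * a)%:R.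
    by rewrite sexpZ mulr1.
  ring.
have geom := @sum_periodic_geometric _ (fun a => sexp (chi a%:Z) 0) d
  (E ^+ (w2 * w3)) w1 _.
have {}geom := geom (fun a => congr1 (fun c => sexp c 0) (chi_per a%:Z)).
have -> : E ^+ (w1 * w2 * w3 * d) = (E ^+ (w2 * w3)) ^+ (d * w1).
  by rewrite -exprM; congr (_ ^+ _); ring.
rewrite -/(charsum _) -/(den _) in geom.
transitivity (sexp w1%:R^-1 0
  * (den (w1 * w2)
     * rescale (w1 * w2)%:R (bern_series (xi ^+ (w1 * w2)) (w3%:R * y1)))
  * (den (w1 * w3) * \sum_(a < d * w1) sexp (chi a%:Z * xi ^+ (a * w2 * w3)) 0
      * rescale (w1 * w3)%:R
        (bern_series (xi ^+ (w1 * w3)) (w2%:R * y2 + w2%:R / w1%:R * a%:R)))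
  * den (w2 * w3)); first by rewrite /convs; ring.
rewrite inner rescale_bern_series.
(* The two factors m t from the Bernoulli series and the factor 1 / w1 multiply to w1 w2 w3 t^2. *)
have -> : sexp (w1 * w2 * w3)%:R 0 =
    sexp w1%:R^-1 0 * sexp (w1 * w2)%:R 0 * sexp (w1 * w3)%:R 0 :> fps K.
  by rewrite !sexpZ; congr (sexp _ _); rewrite !natrM; field.
have -> : sexp 1 ((w1 * w2 * w3)%:R * (y1 + y2)) =
    sexp 1 ((w1 * w2)%:R * (w3%:R * y1)) * sexp 1 ((w1 * w2 * w3)%:R * y2).
  by rewrite sexpM // mulr1; congr (sexp _ _); rewrite !natrM; ring.
transitivity (sexp w1%:R^-1 0 * sexp (w1 * w2)%:R 0 * sexp (w1 * w3)%:R 0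
  * T ^+ 2 * sexp 1 ((w1 * w2)%:R * (w3%:R * y1))
  * sexp 1 ((w1 * w2 * w3)%:R * y2) * charsum (w1 * w2) * charsum (w1 * w3)
  * (den (w2 * w3)
     * \sum_(a < d * w1) sexp (chi a%:Z) 0 * (E ^+ (w2 * w3)) ^+ a)).
  by ring.
by rewrite geom; ring.
Qed.

Lemma den3_neq0 w1 w2 w3 : (0 < w1)%N -> (0 < w2)%N -> (0 < w3)%N ->
  den (w1 * w2) * den (w1 * w3) * den (w2 * w3) != 0.
Proof.
move=> w1_gt0 w2_gt0 w3_gt0.
by rewrite !fps_mulf_neq0 // den_neq0 // muln_gt0 ?w1_gt0 ?w2_gt0.
Qed.

(** The denominator and the right-hand side of [convsE] are invariant under this transposition, and
    the nonzero denominator cancels. The same argument gives [bern_conv_swap12]; the two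
    transpositions generate all permutations. *)
Lemma bern_conv_swap23 n w1 w2 w3 : (0 < w1)%N -> (0 < w2)%N -> (0 < w3)%N ->
  bern_conv n w1 w2 w3 = bern_conv n w1 w3 w2.
Proof.
move=> w1_gt0 w2_gt0 w3_gt0; rewrite !bern_convE //; congr (_ * _).
suff -> : convs w1 w2 w3 = convs w1 w3 w2 by [].
apply: (fps_mulfI (den3_neq0 w1_gt0 w2_gt0 w3_gt0)); rewrite convsE //.
(* The denominators are reordered to match [convsE] at (w1, w3, w2). *)
rewrite [X in X * den (w2 * w3)]mulrC [(w2 * w3)%N]mulnC convsE //.
by rewrite [(w1 * w3 * w2)%N]mulnAC; ring.
Qed.

Lemma bern_conv_swap12 n w1 w2 w3 : (0 < w1)%N -> (0 < w2)%N -> (0 < w3)%N ->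
  bern_conv n w1 w2 w3 = bern_conv n w2 w1 w3.
Proof.
move=> w1_gt0 w2_gt0 w3_gt0; rewrite !bern_convE //; congr (_ * _).
suff -> : convs w1 w2 w3 = convs w2 w1 w3 by [].
apply: (fps_mulfI (den3_neq0 w1_gt0 w2_gt0 w3_gt0)); rewrite convsE //.
rewrite mulrAC [X in _ = X * _]mulrAC [(w1 * w2)%N]mulnC convsE //; ring.
Qed.

End BernoulliSeries.

(** * The identities over C_p *)

Unset Implicit Arguments.

Theorem theorem4p3 (p : nat) (p_prime : prime p)
    (R : realType) (Cp : fieldType) (v : Cp -> R) (hCp : is_Cp v p)
    (iota : {rmorphism algC -> Cp})
    (d : nat) (d_gt0 : (0 < d)%N)
    (chi0 : int -> algC) (hchi : primitive_dirichlet d chi0)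
    (xi : Cp) (hxi : Gamma_r p xi)
    (w1 w2 w3 : nat) (w1_gt0 : (0 < w1)%N) (w2_gt0 : (0 < w2)%N)
    (w3_gt0 : (0 < w3)%N)
    (n : nat) (y1 y2 : Cp) (hy1 : padic_int v y1) (hy2 : padic_int v y2) :
  let chi := fun a : int => iota (chi0 a) in
  let B := fun (k : nat) (eta x : Cp) => (gen_bernoulli d chi eta k).[x] in
  let W1 : Cp := w1%:R in
  let W2 : Cp := w2%:R in
  let W3 : Cp := w3%:R in
  let E1 := W1 ^ (n%:Z - 1) * \sum_(k < n.+1) 'C(n, k)%:R
      * B k (xi ^+ (w1 * w2)) (W3 * y1)
      * (\sum_(a < d * w1) chi a%:Z * xi ^+ (a * w2 * w3)
           * B (n - k)%N (xi ^+ (w1 * w3)) (W2 * y2 + W2 / W1 * a%:R))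
      * W3 ^+ (n - k) * W2 ^+ k in
  let E2 := W1 ^ (n%:Z - 1) * \sum_(k < n.+1) 'C(n, k)%:R
      * B k (xi ^+ (w1 * w3)) (W2 * y1)
      * (\sum_(a < d * w1) chi a%:Z * xi ^+ (a * w2 * w3)
           * B (n - k)%N (xi ^+ (w1 * w2)) (W3 * y2 + W3 / W1 * a%:R))
      * W2 ^+ (n - k) * W3 ^+ k in
  let E3 := W2 ^ (n%:Z - 1) * \sum_(k < n.+1) 'C(n, k)%:R
      * B k (xi ^+ (w1 * w2)) (W3 * y1)
      * (\sum_(a < d * w2) chi a%:Z * xi ^+ (a * w1 * w3)
           * B (n - k)%N (xi ^+ (w2 * w3)) (W1 * y2 + W1 / W2 * a%:R))
      * W3 ^+ (n - k) * W1 ^+ k in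
  let E4 := W2 ^ (n%:Z - 1) * \sum_(k < n.+1) 'C(n, k)%:R
      * B k (xi ^+ (w2 * w3)) (W1 * y1)
      * (\sum_(a < d * w2) chi a%:Z * xi ^+ (a * w1 * w3)
           * B (n - k)%N (xi ^+ (w1 * w2)) (W3 * y2 + W3 / W2 * a%:R))
      * W1 ^+ (n - k) * W3 ^+ k in
  let E5 := W3 ^ (n%:Z - 1) * \sum_(k < n.+1) 'C(n, k)%:R
      * B k (xi ^+ (w1 * w3)) (W2 * y1)
      * (\sum_(a < d * w3) chi a%:Z * xi ^+ (a * w1 * w2)
           * B (n - k)%N (xi ^+ (w2 * w3)) (W1 * y2 + W1 / W3 * a%:R))
      * W2 ^+ (n - k) * W1 ^+ k in
  let E6 := W3 ^ (n%:Z - 1) * \sum_(k < n.+1) 'C(n, k)%:R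
      * B k (xi ^+ (w2 * w3)) (W1 * y1)
      * (\sum_(a < d * w3) chi a%:Z * xi ^+ (a * w1 * w2)
           * B (n - k)%N (xi ^+ (w1 * w3)) (W2 * y2 + W2 / W3 * a%:R))
      * W1 ^+ (n - k) * W2 ^+ k in
  [/\ E1 = E2, E2 = E3, E3 = E4, E4 = E5 & E5 = E6].
Proof.
have K0 := Cp_pchar0 hCp p_prime.
have xi0 : xi != 0.
  have [s s_gt0 xiX] := hxi; apply: contra_eq_neq xiX => ->.
  by rewrite expr0n expn_eq0 -leqn0 leqNgt prime_gt0 // eq_sym oner_eq0.
move=> chi B W1 W2 W3 E1 E2 E3 E4 E5 E6.
have chi_per m : chi (m + d%:Z) = chi m by rewrite /chi (dchar_periodic hchi.1).
pose S := bern_conv d chi xi y1 y2 n.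
have swap23 u v' w : (0 < u)%N -> (0 < v')%N -> (0 < w)%N -> S u v' w = S u w v'.
  exact: bern_conv_swap23.
have swap12 u v' w : (0 < u)%N -> (0 < v')%N -> (0 < w)%N -> S u v' w = S v' u w.
  exact: bern_conv_swap12.
(* Each expression is a value of [S] up to commuting factors in the exponents of xi; those under the
   sum over a need rewriting inside the summand. *)
have E1S : E1 = S w1 w2 w3 by [].
have E2S : E2 = S w1 w3 w2.
  rewrite /E2 /S /bern_conv; congr (_ * _); apply: eq_bigr => k _.
  by do 3 congr (_ * _); apply: eq_bigr => a _; rewrite (mulnAC a).
have E3S : E3 = S w2 w1 w3 by rewrite /E3 [(w1 * w2)%N]mulnC.
have E4S : E4 = S w2 w3 w1.
  rewrite /E4 /S /bern_conv [(w1 * w2)%N]mulnC; congr (_ * _).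
  apply: eq_bigr => k _; do 3 congr (_ * _).
  by apply: eq_bigr => a _; rewrite (mulnAC a).
have E5S : E5 = S w3 w1 w2.
  by rewrite /E5 [(w1 * w3)%N]mulnC [(w2 * w3)%N]mulnC.
have E6S : E6 = S w3 w2 w1.
  rewrite /E6 /S /bern_conv [(w1 * w3)%N]mulnC [(w2 * w3)%N]mulnC.
  congr (_ * _); apply: eq_bigr => k _; do 3 congr (_ * _).
  by apply: eq_bigr => a _; rewrite (mulnAC a).
(* The first, third and fifth equalities exchange the last two arguments; the second and fourth need
   both transpositions. *)
rewrite E1S E2S E3S E4S E5S E6S; split.
- exact: swap23.
- by rewrite swap23 // swap12.
- exact: swap23.
- by rewrite swap12 // swap23.
- exact: swap23.
Qed.
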